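(* Let $d\geqslant 1$ be an integer. There exists a constant $c>0$ (depending only on $d$) such that, for every positive integer $N$, for every even integer $M\geqslant 18dN$ and for every finite sequence $\mathcal P_N=\{p_n\}_{n=1}^N$ in $\mathbb T^d$, \[ \left(\frac{1}{(\operatorname{card}\mathbb J_M)^d}\,\frac{1}{\operatorname{card}\mathbb S_M}\sum_{j_1,\ldots,j_d\in\mathbb J_M}\ \sum_{s\in\mathbb S_M}\left|\mathscr D\left(\Big(\frac{j_1}{M},\ldots,\frac{j_d}{M}\Big)+Q(s),\mathcal P_N\right)\right|^2\right)^{\frac12}\geqslant c\,\log^{\frac{d-1}{2}}(N). \]
   Context: $\mathbb T^d=\mathbb R^d/\mathbb Z^d$. For $s\in(0,1/2)$, $Q(s)=[-s,s)^d+\mathbb Z^d$ is the periodized cube of center $0$ and edge $2s$. For $x\in\mathbb T^d$ and a finite sequence $\mathcal P_N=\{p_n\}_{n=1}^N$ in $\mathbb T^d$, \[ \mathscr D(x+Q(s),\mathcal P_N)=\sum_{n=1}^N\chi_{x+Q(s)}(p_n)-N(2s)^d . \] For an even integer $M$, $\mathbb J_M=\{j\in\mathbb Z:-M/2\leqslant j<M/2\}$ and $\mathbb S_M=\{\frac1M,\frac2M,\ldots,\frac12-\frac1M\}$ (so $\operatorname{card}\mathbb J_M=M$ and $\operatorname{card}\mathbb S_M=M/2-1$). Here $\log^{a}(N)=(\log N)^a$. *)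

(* Defs.v *)
From HB Require Import structures.
From mathcomp Require Import all_boot all_order all_algebra.
From mathcomp Require Import finmap zify ring lra.
From mathcomp Require Import all_classical all_reals all_analysis.

Set Implicit Arguments.
Unset Strict Implicit.
Unset Printing Implicit Defensive.

Import Order.TTheory GRing.Theory Num.Theory.

Local Open Scope classical_set_scope.
Local Open Scope ring_scope.

Section Torus.
Variables (R : realType) (d : nat).

Definition int_lattice : pred 'rV[R]_d :=
  fun y => [forall i, y 0 i \is a Num.int].

Lemma int_lattice_zmod_closed : zmod_closed int_lattice.
Proof.
split; first by apply/forallP => i; rewrite mxE rpred0.
by move=> y z /forallP hy /forallP hz; apply/forallP => i; rewrite !mxE rpredB.
Qed.

HB.instance Definition _ :=
  GRing.isZmodClosed.Build 'rV[R]_d int_lattice int_lattice_zmod_closed.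

(* The quotient group R^d / Z^d. *)
Definition torus : zmodType :=
  Quotient.quot (GRing.ZmodClosed.clone 'rV[R]_d int_lattice _).

Definition to_torus (y : 'rV[R]_d) : torus := (\pi_torus y)%qT.

Lemma to_torusD : {morph to_torus : y z / y + z}.
Proof. by move=> y z; rewrite /to_torus !piE. Qed.

Lemma to_torus_eqP (y z : 'rV[R]_d) :
  reflect (forall i, y 0 i - z 0 i \is a Num.int) (to_torus y == to_torus z).
Proof.
rewrite /to_torus -Quotient.idealrBE; apply: (iffP forallP) => h i;
  by have := h i; rewrite !mxE.
Qed.

(* The periodized cube [-s, s)^d + Z^d, viewed in the torus: the addition of
   Z^d is performed by the projection to the quotient (see mem_translate_Q). *)
Definition Q (s : R) : set torus :=
  to_torus @` [set y : 'rV[R]_d | forall i, - s <= y 0 i < s].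

Definition translate (x : torus) (A : set torus) : set torus :=
  [set x + a | a in A].

Lemma mem_translate_Q (s : R) (x y : 'rV[R]_d) :
  translate (to_torus x) (Q s) (to_torus y) <->
  exists k : 'I_d -> int, forall i, - s <= y 0 i - x 0 i - (k i)%:~R < s.
Proof.
split=> [[_ [z /= hz <-]] | [k hk]].
  rewrite -to_torusD => /eqP/to_torus_eqP h.
  exists (fun i => - Num.floor ((x + z) 0 i - y 0 i)) => i.
  rewrite mulrNz floorK ?h // !mxE opprK.
  by have := hz i; rewrite (_ : y 0 i - _ + _ = z 0 i) //; ring.
exists (to_torus (\row_i (y 0 i - x 0 i - (k i)%:~R))).
  by exists (\row_i (y 0 i - x 0 i - (k i)%:~R)) => //= i; rewrite mxE.
rewrite -to_torusD; apply/eqP/to_torus_eqP => i; rewrite !mxE.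
rewrite (_ : _ - _ = (- k i)%:~R) ?intr_int // mulrNz; ring.
Qed.

Definition discrepancy (x : torus) (s : R) (N : nat) (p : 'I_N -> torus) : R :=
  \sum_(n < N) \1_(translate x (Q s)) (p n) - N%:R * (2 * s) ^+ d.

(* The sets JM M and SM M are used for even M only, where the explicit
   enumerations below agree with their description by inequalities
   (mem_JM, mem_SM). *)
Definition JM (M : nat) : {fset int} :=
  [fset (k%:Z - (M./2)%:Z)%R | k in iota 0 M]%fset.

Definition SM (M : nat) : {fset R} :=
  [fset (k%:R / M%:R)%R | k in iota 1 (M./2).-1]%fset.

Lemma mem_JM M (j : int) : ~~ odd M ->
  (j \in JM M) = (- (M%:R / 2) <= (j%:~R : R) < M%:R / 2).
Proof.
move=> eM.
have M2 : (M%:R : R) / 2 = (M./2)%:R.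
  by rewrite -{1}(even_halfK eM) -muln2 natrM mulfK ?pnatr_eq0.
rewrite M2 [(M./2)%:R](pmulrn 1) -mulrNz ler_int ltr_int.
apply/imfsetP/idP => [[k /=] | /andP[h1 h2]].
  by rewrite mem_iota => hk ->; lia.
exists (absz (j + (M./2)%:Z)) => /=; last by lia.
by rewrite mem_iota; lia.
Qed.

Lemma card_JM M : #|` JM M| = M.
Proof.
rewrite /JM card_imfset /= ?undup_id ?iota_uniq ?size_iota //.
by move=> k l /addIr [].
Qed.

Lemma mem_SM M (s : R) : ~~ odd M -> (0 < M)%N ->
  reflect (exists k : int, s = k%:~R / M%:R /\ 1 / M%:R <= s <= 1 / 2 - 1 / M%:R)
          (s \in SM M).
Proof.
move=> eM M0.
have M0R : 0 < (M%:R : R) by rewrite ltr0n.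
have M2 : (1 : R) / 2 - 1 / M%:R = ((M./2)%:Z - 1)%:~R / M%:R.
  have -> : (M%:R : R) = 2 * (M./2)%:R.
    by rewrite -{1}(even_halfK eM) -muln2 natrM mulrC.
  rewrite intrB /= -pmulrn; field.
  by rewrite pnatr_eq0; lia.
have bnd (k : int) : (1 / M%:R <= (k%:~R : R) / M%:R <= 1 / 2 - 1 / M%:R) =
    (1 <= k <= (M./2)%:Z - 1).
  by rewrite M2 !ler_pM2r ?invr_gt0 // ler_int -[1 in LHS]/(1%:~R) ler_int.
apply: (iffP idP) => [/imfsetP[k /=] | [k [-> ]]].
  rewrite mem_iota => hk ->; exists k%:Z; split; first by rewrite -pmulrn.
  by rewrite [k%:R](pmulrn 1) bnd; lia.
rewrite bnd => hk; apply/imfsetP; exists (absz k) => /=; first by rewrite mem_iota; lia.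
by rewrite [(absz k)%:R](pmulrn 1) gez0_abs //; lia.
Qed.

Lemma card_SM M : (0 < M)%N -> #|` SM M| = (M./2).-1.
Proof.
move=> M0; rewrite /SM card_imfset /= ?undup_id ?iota_uniq ?size_iota //.
move=> k l /mulIf; rewrite invr_eq0 pnatr_eq0 -lt0n => /(_ M0) /eqP.
by rewrite eqr_nat => /eqP.
Qed.

(* A multi-index (j_1, ..., j_d) in (JM M)^d is a function from 'I_d to the
   finite type associated with JM M. *)
Definition grid_point (M : nat) (j : {ffun 'I_d -> JM M}) : torus :=
  to_torus (\row_i ((val (j i))%:~R / M%:R)).

End Torus.

Arguments torus : clear implicits.
Arguments SM : clear implicits.

(* Main.v *)
Require Import Defs.
From HB Require Import structures.
From mathcomp Require Import all_boot all_order all_algebra.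
From mathcomp Require Import finmap zify ring lra complex.
From mathcomp Require Import all_classical all_reals all_analysis.

Set Implicit Arguments.
Unset Strict Implicit.
Unset Printing Implicit Defensive.

Import Order.TTheory GRing.Theory Num.Theory numFieldNormedType.Exports.

Local Open Scope ring_scope.

(* The cubes considered have their corners in the grid (1/M)Z^d, so each p_n may be moved
   down to that grid and the problem becomes one on the group (Z/M)^d.  There the
   discrepancy is the convolution of the points with a cyclic cube, and Plancherel reduces
   the sum over x to a sum over nonzero frequencies m of |S(m)|^2 times
   prod_i |A_k(m_i)|^2, with S the exponential sum of the points and A_k the transform of
   the interval [-k, k).  With w = exp(2 i pi / M) and mu_i = max(1, |m_i|),
   |A_k(m_i)| >= |1 - w^(2 k mu_i)| / (mu_i |1 - w|); since prod_i (1 - w^(2 k mu_i)) has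
   mean 1 over k as soon as sum_i mu_i < M/2 (this is where M >= 18dN enters), averaging
   over k leaves sum |S(m)|^2 / prod_i mu_i^2 over these frequencies.  Following Roth and
   Cassels-Montgomery, each of the about (log N)^(d-1) dyadic boxes of volume 2^n, with
   2N <= 2^n < 4N, contributes at least a constant to this sum, and the boxes overlap
   boundedly with respect to the weight. *)

(** * Fourier analysis on the group of residues *)

Lemma val_subZp M' (u a : 'I_M'.+2) :
  (u - a)%R = (if (a <= u)%N then u - a else u + M'.+2 - a)%N :> nat.
Proof.
have uM := ltn_ord u; have aM := ltn_ord a; rewrite /=; case: (posnP a) => [->|a0].
  by rewrite subn0 modnn addn0 modn_small // leq0n subn0.
rewrite (@modn_small (_ - a)); last by lia.
case: (leqP a u) => au; last by rewrite modn_small; lia.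
rewrite (_ : (u + (M'.+2 - a) = (u - a) + M'.+2)%N); last by lia.
by rewrite modnDr modn_small; lia.
Qed.

Section Characters.
Variables (C : numClosedFieldType) (M' d : nat) (w : C).
Local Notation M := M'.+2.
Local Notation G := {ffun 'I_d -> 'I_M'.+2}.
Hypothesis wM : M.-primitive_root w.

Definition psi (x : 'I_M) : C := w ^+ x.

Lemma psi0 : psi 0 = 1.
Proof. by rewrite /psi expr0. Qed.

Lemma psiD x y : psi (x + y) = psi x * psi y.
Proof. by rewrite /psi /= (prim_expr_mod wM) exprD. Qed.

Lemma psiM x y : psi (x * y) = psi x ^+ y.
Proof. by rewrite /psi /= (prim_expr_mod wM) exprM. Qed.

Lemma normw : `|w| = 1.
Proof.
apply/eqP; rewrite -(@pexpr_eq1 _ _ M) //.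
by rewrite -normrX (prim_expr_order wM) normr1.
Qed.

Lemma psi_norm x : `|psi x| = 1.
Proof. by rewrite normrX normw expr1n. Qed.

Lemma psiN x : psi (- x) = (psi x)^*.
Proof.
have nz : psi x != 0 by rewrite -normr_eq0 psi_norm oner_eq0.
apply: (mulfI nz); rewrite -psiD subrr psi0.
by rewrite -normCK psi_norm expr1n.
Qed.

Lemma psi_eq1 x : (psi x == 1) = (x == 0).
Proof.
rewrite /psi -(prim_order_dvd wM) /dvdn modn_small //.
Qed.

Lemma sum_psi m : \sum_x psi (m * x) = if m == 0 then M%:R else 0.
Proof.
case: eqP => [->|/eqP m0].
  under eq_bigr => x _ do rewrite mul0r psi0.
  by rewrite sumr_const card_ord.
under eq_bigr => x _ do rewrite psiM.
apply/eqP; have := subrX1 (psi m) M.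
rewrite -exprM mulnC exprM (prim_expr_order wM) expr1n subrr => /esym/eqP.
by rewrite mulf_eq0 subr_eq0 psi_eq1 (negPf m0).
Qed.

(** This is [w] to the power of the dot product of [m] and [x]: frequencies and points live in the
    same group and the pairing is symmetric. *)
Definition chi (m x : G) : C := \prod_i psi (m i * x i).

Lemma chiC m x : chi m x = chi x m.
Proof. by apply: eq_bigr => i _; rewrite mulrC. Qed.

Lemma chi0 x : chi 0 x = 1.
Proof. by apply: big1 => i _; rewrite ffunE mul0r psi0. Qed.

Lemma chiD m x y : chi m (x + y) = chi m x * chi m y.
Proof. by rewrite -big_split; apply: eq_bigr => i _; rewrite ffunE mulrDr psiD. Qed.

Lemma chiN m x : chi m (- x) = (chi m x)^*.
Proof.
by rewrite rmorph_prod; apply: eq_bigr => i _; rewrite ffunE mulrN psiN.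
Qed.

Lemma chiB m x y : chi m (x - y) = chi m x * (chi m y)^*.
Proof. by rewrite chiD chiN. Qed.

Lemma sum_chi m : \sum_x chi m x = if m == 0 then M%:R ^+ d else 0.
Proof.
rewrite -(bigA_distr_bigA (fun i u => psi (m i * u))) /=.
under eq_bigr => i _ do rewrite sum_psi.
case: eqP => [->|/eqP m0].
  under eq_bigr => i _ do rewrite ffunE eqxx.
  by rewrite prodr_const card_ord.
have [i mi] : exists i, m i != 0.
  apply/existsP; apply: contraNT m0; rewrite negb_exists => /forallP h.
  by apply/eqP/ffunP => i; rewrite ffunE; apply/eqP; have := h i; rewrite negbK.
by apply/eqP/prodf_eq0; exists i; rewrite // (negPf mi).
Qed.

Lemma plancherel (f : G -> C) :
  \sum_m `|\sum_x f x * chi m x| ^+ 2 = M%:R ^+ d * \sum_x `|f x| ^+ 2.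
Proof.
under eq_bigr => m _.
  rewrite normCK rmorph_sum big_distrlr /=.
  under eq_bigr => x _ do under eq_bigr => y _ do
    rewrite rmorphM /= mulrACA -chiB chiC.
  over.
rewrite exchange_big mulr_sumr /=; apply: eq_bigr => x _.
rewrite exchange_big /= (bigD1 x) //= -mulr_sumr sum_chi subrr eqxx.
rewrite normCK [RHS]mulrC big1 ?addr0 // => y yx.
by rewrite -mulr_sumr sum_chi subr_eq0 eq_sym (negPf yx) mulr0.
Qed.

Section ExponentialSum.
Variables (N : nat) (q : 'I_N -> G).

Definition expsum (m : G) : C := \sum_n chi m (q n).

Lemma expsum0 : expsum 0 = N%:R.
Proof.
rewrite /expsum; under eq_bigr => n _ do rewrite chi0.
by rewrite sumr_const card_ord.
Qed.

(* Only the diagonal pairs [n = n'] of the expanded square are kept. *)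
Lemma expsum_difference_ge (B : {set G}) :
  N%:R * #|B|%:R ^+ 2 <= \sum_(a in B) \sum_(b in B) `|expsum (a - b)| ^+ 2.
Proof.
have -> : \sum_(a in B) \sum_(b in B) `|expsum (a - b)| ^+ 2 =
    \sum_n \sum_n' `|\sum_(a in B) chi a (q n - q n')| ^+ 2.
  transitivity (\sum_(a in B) \sum_(b in B) \sum_n \sum_n'
      chi a (q n - q n') * (chi b (q n - q n'))^*).
    apply: eq_bigr => a _; apply: eq_bigr => b _.
    rewrite normCK rmorph_sum big_distrlr /=.
    apply: eq_bigr => n _; apply: eq_bigr => n' _.
    by rewrite -chiB chiC chiB ![chi (q n - q n') _]chiC.
  under eq_bigr => a _ do rewrite exchange_big.
  rewrite exchange_big; apply: eq_bigr => n _.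
  under eq_bigr => a _ do rewrite exchange_big.
  rewrite exchange_big; apply: eq_bigr => n' _.
  by rewrite normCK rmorph_sum big_distrlr.
rewrite -[N in N%:R]card_ord -sumr_const mulr_suml.
apply: ler_sum => n _; rewrite mul1r (bigD1 n) //= ler_wpDr //.
  by apply: sumr_ge0 => n' _; rewrite exprn_ge0.
rewrite subrr; under eq_bigr => a _ do rewrite chiC chi0.
by rewrite sumr_const ger0_norm.
Qed.

(** For fixed [b], a frequency [m] of [T] is [a - b] for at most one [a] in [B], so the double sum
    over [B] is at most [#|B|] times the sum over [T] with frequency 0 included. Frequency 0
    accounts for [N ^ 2]; dividing by [#|B|] leaves the claim. *)
Lemma expsum_nonzero_ge (B T : {set G}) :
    (forall a b, a \in B -> b \in B -> a - b \in T) -> (0 < #|B|)%N ->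
  N%:R * (#|B|%:R - N%:R) <= \sum_(m in T | m != 0) `|expsum m| ^+ 2.
Proof.
move=> BT B0; have B0' : 0 < #|B|%:R :> C by rewrite ltr0n.
rewrite -(ler_pM2r B0').
have : \sum_(a in B) \sum_(b in B) `|expsum (a - b)| ^+ 2 <=
    \sum_(b in B) (N%:R ^+ 2 + \sum_(m in T | m != 0) `|expsum m| ^+ 2).
  rewrite exchange_big; apply: ler_sum => b bB; rewrite (bigD1 b) //=.
  rewrite subrr expsum0 normr_nat lerD2l.
  rewrite (reindex_onto (fun m : G => m + b : G) (fun a : G => a - b : G)) /=; last first.
    by move=> a _; rewrite subrK.
  rewrite [leRHS](bigID (fun m => m + b \in B)) /= ler_wpDr //.
    by apply: sumr_ge0 => m _; rewrite exprn_ge0.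
  under eq_bigr => m _ do rewrite addrK.
  rewrite le_eqVlt; apply/orP; left; apply/eqP/eq_bigl => m.
  rewrite addrK eqxx andbT -subr_eq0 addrK.
  case mB: (m + b \in B); rewrite ?andbF //= andbT.
  by have := BT _ _ mB bB; rewrite addrK => ->.
move/(le_trans (expsum_difference_ge B)); rewrite sumr_const -[leRHS]mulr_natr.
rewrite (_ : _ * _ * _ = N%:R * #|B|%:R ^+ 2 - N%:R ^+ 2 * #|B|%:R); last by ring.
by rewrite lerBlDl -mulrDl.
Qed.
End ExponentialSum.

End Characters.

(** * Discrepancy of cyclic cubes *)

Lemma sum_expr_prim_root (F : fieldType) (z : F) (H t : nat) :
  H.-primitive_root z -> (0 < t < H)%N -> \sum_(k < H) z ^+ (k * t) = 0.
Proof.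
move=> zH /andP[t0 tH].
have zt1 : z ^+ t != 1.
  by rewrite -(prim_order_dvd zH); apply: contraL tH => /(dvdn_leq t0); rewrite leqNgt.
under eq_bigr => k _ do rewrite mulnC exprM.
apply/eqP; have := subrX1 (z ^+ t) H.
rewrite -exprM mulnC exprM (prim_expr_order zH) expr1n subrr => /esym/eqP.
by rewrite mulf_eq0 subr_eq0 (negPf zt1).
Qed.

(* As [0 < \sum_(i in S) mu i < H] for nonempty [S], only the constant term of the
   expanded product [P k] survives averaging over [k], so [P] has mean 1; conclude by
   [|P|^2 >= 2 Re P - 1]. *)
Lemma mean_prod_ge1 (C : numClosedFieldType) (d H : nat) (z : C) (mu : 'I_d -> nat) :
    H.-primitive_root z -> (forall i, 0 < mu i)%N -> (\sum_i mu i < H)%N ->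
  H%:R <= \sum_(k < H) \prod_i `|1 - z ^+ (k * mu i)| ^+ 2.
Proof.
move=> zH mu0 muH; pose P (k : 'I_H) := \prod_i (1 - z ^+ (k * mu i)).
have sumP : \sum_k P k = H%:R.
  transitivity (\sum_(k < H) \sum_(S : {set 'I_d})
      \prod_i (if i \in S then - z ^+ (k * mu i) else 1)).
    apply: eq_bigr => k _; rewrite -bigA_distr.
    by apply: eq_bigr => i _; rewrite addrC.
  rewrite exchange_big /= (bigD1 finset.set0) //= (eq_bigr (fun=> 1)); last first.
    by move=> k _; rewrite big1 // => i _; rewrite finset.in_set0.
  rewrite sumr_const card_ord.
  rewrite big1 ?addr0 // => S /finset.set0Pn[i0 i0S].
  have tS : (0 < \sum_(i in S) mu i < H)%N.
    apply/andP; split.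
      by apply: leq_trans (mu0 i0) _; rewrite (bigD1 i0) //= leq_addr.
    by apply: leq_ltn_trans muH; rewrite [leqRHS](bigID (fun i => i \in S)) /= leq_addr.
  transitivity ((-1) ^+ #|S| * \sum_(k < H) z ^+ (k * \sum_(i in S) mu i)).
    rewrite mulr_sumr; apply: eq_bigr => k _; rewrite -big_mkcond prodrN.
    by rewrite prodrXr big_distrr.
  by rewrite sum_expr_prim_root // mulr0.
(* [H] becomes [H + H - H], then the sum over [k] of [P k + (P k)^* - 1]. *)
rewrite -{1}[H%:R](addrK H%:R) -{1}sumP -[X in _ + X - _]conjC_nat -{1}sumP.
rewrite rmorph_sum -big_split /= -[in X in _ - X](card_ord H) -sumr_const -sumrB.
apply: ler_sum => k _; rewrite -subr_ge0.
have -> : \prod_i `|1 - z ^+ (k * mu i)| ^+ 2 = P k * (P k)^*.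
  by rewrite -normCK normr_prod -prodrXl.
rewrite (_ : _ - _ = `|P k - 1| ^+ 2) ?exprn_ge0 //.
by rewrite normCK rmorphB rmorph1; ring.
Qed.

(* The cyclic interval [- k, k[ modulo [M]. *)
Definition arc M (k : nat) : pred 'I_M := fun u => (u < k)%N || (M - k <= u)%N.
Arguments arc {M}.

(** Lengths are counted in units of [1 / M]. The field is left open: the Fourier analysis is
    complex, the final estimate real. *)
Definition discrepancy_mod (F : fieldType) M' d N (q : 'I_N -> {ffun 'I_d -> 'I_M'.+2})
    (k : nat) (x : {ffun 'I_d -> 'I_M'.+2}) : F :=
  \sum_n \prod_i (arc k (q n i - x i))%:R - N%:R * ((2 * k%:R) / M'.+2%:R) ^+ d.

Section DiscreteDiscrepancy.
Variables (C : numClosedFieldType) (M' d : nat) (w : C).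
Local Notation M := M'.+2.
Local Notation G := {ffun 'I_d -> 'I_M'.+2}.

Lemma sum_arc (F : nat -> C) k : (k.*2 <= M)%N ->
  \sum_(u : 'I_M | arc k u) F u = \sum_(0 <= u < k) F u + \sum_(M - k <= u < M) F u.
Proof.
move=> kM; rewrite -(big_mkord (fun u => (u < k)%N || (M - k <= u)%N) F).
rewrite (@big_cat_nat _ _ _ k) //=; last by lia.
rewrite [X in _ + X](@big_cat_nat _ _ _ (M - k)) ?leq_subr //=; last by lia.
rewrite [X in _ + (X + _)]big_nat_cond [X in _ + (X + _)]big_pred0 ?add0r; last by move=> u; lia.
congr (_ + _); rewrite big_nat_cond [RHS]big_nat_cond; apply: eq_bigl => u; lia.
Qed.

(** Both runs of the arc telescope, and their ends at [0] and [M] cancel since [z ^+ M = 1]. *)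
Lemma arc_geometric_sum (z : C) k : (k.*2 <= M)%N -> z ^+ M = 1 ->
  (\sum_(u : 'I_M | arc k u) z ^+ u) * (z - 1) = z ^+ k - z ^+ (M - k).
Proof.
move=> kM zM.
have tel a b : (a <= b)%N -> \sum_(a <= u < b) z ^+ u * (z - 1) = z ^+ b - z ^+ a.
  move=> ab; rewrite -(telescope_sumr _ ab).
  by apply: eq_bigr => u _; rewrite mulrBr mulr1 -exprSr.
rewrite (sum_arc (fun u => z ^+ u)) // mulrDl !mulr_suml !tel ?leq_subr // zM expr0.
by ring.
Qed.

Lemma sum1_arc k : (k.*2 <= M)%N -> \sum_(u : 'I_M | arc k u) 1 = k.*2%:R :> C.
Proof.
move=> kM; rewrite (sum_arc (fun=> 1)) // !sumr_const_nat -mulrnDr.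
by congr (1 *+ _); lia.
Qed.

(* The distance of [m] to 0 modulo [M], except that frequency 0 counts as 1: the sum over
   the arc is then [2 k], which is at least [|1 - w ^ (2 k)| / |1 - w|]. *)
Definition freq_size (m : 'I_M) : nat := maxn 1 (minn m (M - m)).

Lemma freq_size_gt0 m : (0 < freq_size m)%N.
Proof. by rewrite leq_max. Qed.

Hypothesis wM : M.-primitive_root w.

Local Notation psi := (@psi C M' w).
Local Notation chi := (@chi C M' d w).

Lemma freq_sizeP m : m != 0 -> psi m = w ^+ freq_size m \/ psi m = (w ^+ freq_size m)^*.
Proof.
move=> m0; have m0' : (0 < m)%N by rewrite lt0n.
case: (leqP m (M - m)) => h; [left|right].
  by rewrite /freq_size; congr (_ ^+ _); lia.
have mM := ltn_ord m; have -> : w ^+ freq_size m = psi (- m).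
  by rewrite /psi /= (prim_expr_mod wM) /freq_size; congr (_ ^+ _); lia.
by rewrite -(psiN wM) opprK.
Qed.

Lemma norm_1subX_le j : `|1 - w ^+ j| <= j%:R * `|1 - w|.
Proof.
rewrite -opprB normrN subrX1 normrM mulrC distrC ler_wpM2r //.
rewrite (le_trans (ler_norm_sum _ _ _)) // -[j in j%:R]card_ord -sumr_const.
by apply: ler_sum => i _; rewrite normrX (normw wM) expr1n.
Qed.

(** For [m != 0] and [mu = freq_size m], the geometric sum has modulus
    [|1 - w^(2 k mu)| / |1 - w^mu|], with denominator at most [mu |1 - w|]. *)
Lemma arc_sum_ge k m : (k.*2 <= M)%N ->
  `|1 - w ^+ (k.*2 * freq_size m)| <=
  `|\sum_(u | arc k u) psi (- (m * u))| * ((freq_size m)%:R * `|1 - w|).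
Proof.
move=> kM; case: (eqVneq m 0) => [->|m0].
  rewrite [freq_size 0](_ : _ = 1%N); last by rewrite /freq_size /=; lia.
  under eq_bigr => u _ do rewrite mul0r oppr0 psi0.
  by rewrite sum1_arc // normr_nat muln1 mul1r norm_1subX_le.
pose z := psi (- m).
have zM : z ^+ M = 1 by rewrite /z /psi -exprM mulnC exprM (prim_expr_order wM) expr1n.
have -> : `|\sum_(u | arc k u) psi (- (m * u))| = `|\sum_(u : 'I_M | arc k u) z ^+ u|.
  by congr (`|_|); apply: eq_bigr => u _; rewrite -mulNr (psiM wM).
have zE : z = w ^+ freq_size m \/ z = (w ^+ freq_size m)^*.
  by rewrite /z (psiN wM); case: (freq_sizeP m0) => ->; [right|left; rewrite conjCK].
have norm1z j : `|1 - z ^+ j| = `|1 - w ^+ (j * freq_size m)|.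
  rewrite mulnC exprM; case: zE => -> //.
  by rewrite -rmorphXn -(norm_conjC (1 - _)) rmorphB rmorph1 /= conjCK.
have -> : `|1 - w ^+ (k.*2 * freq_size m)| = `|(\sum_(u : 'I_M | arc k u) z ^+ u) * (z - 1)|.
  rewrite arc_geometric_sum // -norm1z.
  (* Factoring out the unimodular [z ^+ (M - k)] leaves [1 - z ^+ k.*2] up to sign. *)
  rewrite (_ : z ^+ k = z ^+ (M - k) * z ^+ k.*2); last first.
    by rewrite -exprD -[in LHS](mul1r (z ^+ k)) -zM -exprD; congr (_ ^+ _); lia.
  rewrite -{2}[z ^+ (M - k)]mulr1 -mulrBr normrM normrX (psi_norm wM) expr1n mul1r.
  by rewrite distrC.
rewrite normrM ler_wpM2l // distrC -[z]expr1 norm1z mul1n norm_1subX_le //.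
Qed.

Variables (N : nat) (q : 'I_N -> G).

(** The volume term is constant in [x] and vanishes at nonzero frequencies. The counting term is a
    convolution, and the transform of a cube has one factor per coordinate. *)
Lemma discrepancy_mod_fourier k (m : G) : m != 0 ->
  \sum_x discrepancy_mod C q k x * chi m x =
  expsum w q m * \prod_i \sum_(u | arc k u) psi (- (m i * u)).
Proof.
move=> m0; under [LHS]eq_bigr => x _ do rewrite mulrBl.
rewrite sumrB -mulr_sumr (sum_chi wM) (negPf m0) mulr0 subr0.
under [LHS]eq_bigr => x _ do rewrite mulr_suml.
rewrite exchange_big mulr_suml; apply: eq_bigr => n _ /=.
under [LHS]eq_bigr => x _ do rewrite -big_split /=.
rewrite -(bigA_distr_bigA (fun i u => (arc k (q n i - u))%:R * psi (m i * u))) /=.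
rewrite -big_split; apply: eq_bigr => i _ /=.
rewrite (reindex_onto (fun u => q n i - u) (fun u => q n i - u)) /=; last first.
  by move=> u _; rewrite subKr.
rewrite mulr_sumr [RHS]big_mkcond; apply: eq_big => [u|u _].
  by rewrite subKr eqxx.
rewrite subKr mulrBr (psiD wM); case: (arc k u); first by rewrite mul1r.
by rewrite mul0r.
Qed.

Lemma discrepancy_mod_energy (T : {set G}) : ~~ odd M ->
    (forall m, m \in T -> (\sum_i freq_size (m i) < M./2)%N) ->
  (M./2)%:R * (\sum_(m in T | m != 0) `|expsum w q m| ^+ 2 / (\prod_i freq_size (m i) ^ 2)%N%:R) <=
  `|1 - w| ^+ (2 * d) * M%:R ^+ d *
    \sum_(k < M./2) \sum_x `|discrepancy_mod C q k x| ^+ 2.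
Proof.
move=> eM Tsmall; set H := M./2.
have HM : M = (2 * H)%N by rewrite /H mul2n even_halfK.
(* In [arc_sum_ge] the index [k] enters doubled, so [w ^+ 2] is the root to average; its order [H]
   makes [k < H] a full period. *)
have zH : H.-primitive_root (w ^+ 2).
  have := exp_prim_root wM 2; rewrite (_ : (M %/ _)%N = H) // (gcdn_idPl _) HM ?mulKn //.
  by rewrite dvdn_mulr.
have hk (k : 'I_H) : (k.*2 <= M)%N by have := ltn_ord k; rewrite HM; lia.
rewrite -mulrA [M%:R ^+ d * _]mulr_sumr.
under [in leRHS]eq_bigr => k _ do rewrite -(plancherel wM).
rewrite exchange_big [leRHS]mulr_sumr [leRHS](bigID (fun m => (m \in T) && (m != 0))) /=.
rewrite ler_wpDr //.
  by apply: sumr_ge0 => m _; rewrite mulr_ge0 ?exprn_ge0 ?sumr_ge0 // => k _; rewrite exprn_ge0.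
rewrite mulr_sumr; apply: ler_sum => m /andP[mT m0].
rewrite mulrA ler_pdivrMr; last first.
  by rewrite ltr0n prodn_gt0 // => i; rewrite expn_gt0 freq_size_gt0.
under eq_bigr => k _ do rewrite discrepancy_mod_fourier // normrM exprMn.
rewrite -mulr_sumr mulrC mulrCA -[leRHS]mulrA ler_wpM2l ?exprn_ge0 //.
apply: le_trans (mean_prod_ge1 zH (fun i => freq_size_gt0 (m i)) (Tsmall _ mT)) _.
rewrite mulr_sumr mulr_suml; apply: ler_sum => k _.
rewrite normr_prod -prodrXl natr_prod -[X in _ ^+ (2 * X)](card_ord d) exprM.
rewrite -prodr_const -!big_split /=; apply: ler_prod => i _; rewrite exprn_ge0 //=.
rewrite -exprM mulnA mul2n natrX -!exprMn lerXn2r ?nnegrE ?mulr_ge0 //.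
by apply: le_trans (arc_sum_ge (m i) (hk k)) _; rewrite mulrCA mulrA mulrAC -mulrA mulrC.
Qed.

End DiscreteDiscrepancy.

(** * Dyadic boxes of frequencies *)

Lemma geometric_tail_le (F : realFieldType) (mu B : nat) : (0 < mu)%N ->
  \sum_(r < B) (if (mu <= 2 ^ r)%N then 4^-1 ^+ r else 0) <= 2 / mu%:R ^+ 2 :> F.
Proof.
move=> mu0; have mu0' : 0 < mu%:R :> F by rewrite ltr0n.
have le4 r : (mu <= 2 ^ r)%N -> 4^-1 ^+ r <= (mu%:R ^+ 2)^-1 :> F.
  move=> h; rewrite exprVn lef_pV2 ?posrE ?exprn_gt0 // -natrX -[4 ^+ r]natrX ler_nat.
  by rewrite -[4%N]/(2 ^ 2)%N -expnM mulnC expnM leq_exp2r.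
(* Strengthened for the induction on [B]: the subtracted [4 / 3 * 4^-1 ^+ B] is the sum of the whole
   series from [B] on. *)
suff : \sum_(r < B) (if (mu <= 2 ^ r)%N then 4^-1 ^+ r else 0) <=
    if (mu <= 2 ^ B)%N then 2 / mu%:R ^+ 2 - 4 / 3 * 4^-1 ^+ B else 0 :> F.
  move=> /le_trans; apply; have h : 0 <= 4^-1 ^+ B :> F by rewrite exprn_ge0.
  have h' : 0 <= (mu%:R ^+ 2)^-1 :> F by rewrite invr_ge0 exprn_ge0.
  by case: ifP => _; lra.
elim: B => [|B IH].
  rewrite big_ord0; case: ifP => // h; have := le4 0%N h.
  by rewrite expr0; lra.
rewrite big_ord_recr /=; move: IH; case: (leqP mu (2 ^ B)) => h IH.
  rewrite (leq_trans h) ?leq_exp2l // [4^-1 ^+ B.+1]exprS; lra.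
rewrite addr0; apply: le_trans IH _; case: ifP => // h'.
have q0 : 0 <= 4^-1 ^+ B.+1 :> F by rewrite exprn_ge0.
by have := le4 _ h'; lra.
Qed.

Section DyadicBoxes.
Variables (d n B : nat).

(* The last side length of the box is forced by requiring volume [2 ^ n]. *)
Definition box_exp (rho : {ffun 'I_d -> 'I_B}) (i : 'I_d.+1) : nat :=
  if unlift ord0 i is Some j then rho j else (n - \sum_j rho j)%N.

Lemma box_exp_ord0 rho : box_exp rho ord0 = (n - \sum_j rho j)%N.
Proof. by rewrite /box_exp unlift_none. Qed.

Lemma box_exp_lift rho j : box_exp rho (lift ord0 j) = rho j.
Proof. by rewrite /box_exp liftK. Qed.

Hypothesis B_small : (d * B.-1 <= n)%N.

(** Makes the truncated subtraction in [box_exp] exact. *)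
Lemma sum_ffun_le (rho : {ffun 'I_d -> 'I_B}) : (\sum_j rho j <= n)%N.
Proof.
apply: leq_trans B_small; rewrite -[in leqRHS](card_ord d) -sum_nat_const.
by apply: leq_sum => j _; have := ltn_ord (rho j); lia.
Qed.

Lemma sum_box_exp rho : (\sum_i box_exp rho i = n)%N.
Proof.
rewrite big_ord_recl box_exp_ord0 (eq_bigr _ (fun j _ => box_exp_lift rho j)).
by rewrite subnK // sum_ffun_le.
Qed.

Lemma box_exp_le rho i : (box_exp rho i <= n)%N.
Proof. by rewrite -[leqRHS](sum_box_exp rho) (bigD1 i) //= leq_addr. Qed.

(** Bounded overlap: the weight [1 / prod mu_i^2] is at least [1 / (2^d 4^n)] times the number of
    boxes containing the frequency. The forced side gives [1 <= 4^(n - sum rho) / mu_0^2], and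
    summing over [rho] leaves a product of [d] geometric tails. *)
Lemma count_boxes (mu : 'I_d.+1 -> nat) :
    (forall i, 0 < mu i)%N ->
  (#|[set rho | [forall i, (mu i <= 2 ^ box_exp rho i)%N]]| * \prod_i mu i ^ 2
     <= 2 ^ d * 4 ^ n)%N.
Proof.
move=> mu0; have mu0' i : 0 < (mu i)%:R ^+ 2 :> rat by rewrite exprn_gt0 // ltr0n.
pose f (i : 'I_d) r : rat := if (mu (lift ord0 i) <= 2 ^ r)%N then 4^-1 ^+ r else 0.
rewrite -(ler_nat rat) natrM natr_prod natrM natrX natrX.
rewrite -sum1_card natr_sum big_mkcond /=.
have le_f (rho : {ffun 'I_d -> 'I_B}) :
    (if rho \in [set rho | [forall i, (mu i <= 2 ^ box_exp rho i)%N]] then 1%:R else 0) <=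
    4 ^+ n / (mu ord0)%:R ^+ 2 * \prod_i f i (rho i).
  rewrite finset.in_set; case: forallP => h; last first.
    rewrite mulr_ge0 ?divr_ge0 ?exprn_ge0 ?prodr_ge0 // => i _.
    by rewrite /f; case: ifP => // _; rewrite exprn_ge0.
  have -> : \prod_i f i (rho i) = 4^-1 ^+ \sum_i rho i.
    rewrite -prodrXr; apply: eq_bigr => i _; have := h (lift ord0 i).
    by rewrite /f box_exp_lift => ->.
  have := h ord0; rewrite box_exp_ord0 => h0.
  rewrite mulrAC ler_pdivlMr // mul1r.
  rewrite -(subnK (sum_ffun_le rho)) exprD -mulrA -exprMn divff // expr1n mulr1.
  by rewrite -natrX -[4 ^+ _]natrX ler_nat -[4%N]/(2 ^ 2)%N -expnM mulnC expnM leq_exp2r.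
apply: le_trans (_ : (4 ^+ n / (mu ord0)%:R ^+ 2 * \prod_i (2 / (mu (lift ord0 i))%:R ^+ 2)) *
    (\prod_i (mu i ^ 2)%:R) <= _); last first.
  rewrite big_ord_recl mulrACA natrX divfK ?gt_eqF // -big_split /=.
  rewrite (eq_bigr (fun=> 2)) => [|i _]; last by rewrite natrX divfK // gt_eqF.
  by rewrite prodr_const card_ord mulrC.
rewrite ler_wpM2r ?prodr_ge0 //.
apply: le_trans (ler_sum _ (fun rho _ => le_f rho)) _.
rewrite -mulr_sumr -(bigA_distr_bigA (fun i (r : 'I_B) => f i r)) /=.
rewrite ler_wpM2l ?divr_ge0 ?exprn_ge0 //; apply: ler_prod => i _.
rewrite geometric_tail_le // andbT sumr_ge0 // => r _.
by rewrite /f; case: ifP => // _; rewrite exprn_ge0.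
Qed.

End DyadicBoxes.

(** * Lower bound for the discrete discrepancy *)

Section Roth.
Variables (C : numClosedFieldType) (M' d : nat) (w : C).
Local Notation M := M'.+2.
Local Notation G := {ffun 'I_d.+1 -> 'I_M'.+2}.
Hypothesis wM : M.-primitive_root w.
Variables (N : nat) (q : 'I_N -> G).

Definition dyadic_freq n B (rho : {ffun 'I_d -> 'I_B}) : {set G} :=
  [set m : G | [forall i, (freq_size (m i) <= 2 ^ box_exp n rho i)%N]].

Lemma freq_sizeB (K : nat) (a b : 'I_M) :
  (a < K)%N -> (b < K)%N -> (freq_size (a - b)%R <= K)%N.
Proof.
move=> aK bK; have aM := ltn_ord a; have bM := ltn_ord b.
by rewrite /freq_size val_subZp; case: (leqP b a) => ab; lia.
Qed.

(** [Bx] is a product of intervals starting at 0, whose differences stay in the dyadic set. As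
    [2 ^ n <= M], the intervals fit among the residues and [Bx] has exactly [2 ^ n] elements. *)
Lemma dyadic_expsum_ge n B (rho : {ffun 'I_d -> 'I_B}) :
    (d * B.-1 <= n)%N -> (2 ^ n <= M)%N ->
  N%:R * ((2 ^ n)%:R - N%:R) <= \sum_(m in dyadic_freq n rho | m != 0) `|expsum w q m| ^+ 2.
Proof.
move=> hn nM.
pose K i : {pred 'I_M} := fun a => (a < 2 ^ box_exp n rho i)%N.
pose Bx : {set G} := [set a in family K].
have cardK i : #|K i| = (2 ^ box_exp n rho i)%N.
  have le : (2 ^ box_exp n rho i <= M)%N.
    by apply: leq_trans nM; rewrite leq_exp2l // box_exp_le.
  rewrite -sum1_card -(big_mkord (fun a => a < 2 ^ box_exp n rho i)%N (fun=> 1%N)).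
  rewrite (@big_cat_nat _ _ _ (2 ^ box_exp n rho i)) //=.
  rewrite [X in (_ + X)%N]big_nat_cond [X in (_ + X)%N]big_pred0 ?addn0; last by move=> a; lia.
  rewrite big_nat_cond (eq_bigl (fun a => (0 <= a < 2 ^ box_exp n rho i)%N && true));
    last by move=> a; lia.
  by rewrite -big_nat_cond sum_nat_const_nat subn0 muln1.
have cardB : #|Bx| = (2 ^ n)%N.
  rewrite finset.cardsE card_family foldrE big_map big_enum /=.
  rewrite -[in RHS](sum_box_exp hn rho) expn_sum.
  by apply: eq_bigr => i _; rewrite cardK.
rewrite -cardB; apply: expsum_nonzero_ge => //; last by rewrite cardB expn_gt0.
move=> a b; rewrite !finset.in_set => /familyP aK /familyP bK.
apply/forallP => i; rewrite !ffunE; apply: freq_sizeB; [exact: aK|exact: bK].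
Qed.

(** Each of the [B ^ d] boxes yields at least a multiple of [4 ^ n], and [count_boxes] pays for the
    overlap when the sums are exchanged. *)
Lemma discrepancy_mod_ge n B : ~~ odd M ->
    (2 * N <= 2 ^ n)%N -> (2 ^ n < 4 * N)%N -> (18 * d.+1 * N <= M)%N -> (d * B.-1 <= n)%N ->
  (M./2)%:R * (B ^ d)%:R <= (8 * 2 ^ d)%:R *
    (`|1 - w| ^+ (2 * d.+1) * M%:R ^+ d.+1 *
     \sum_(k < M./2) \sum_x `|discrepancy_mod C q k x| ^+ 2).
Proof.
move=> eM n1 n2 hM hn; have nM : (2 ^ n <= M)%N by nia.
pose T : {set G} := [set m : G | (\sum_i freq_size (m i) < M./2)%N].
(* Each side is at most [2 ^ n], so the sizes add up to at most [d.+1 * 2 ^ n < 4 * (d.+1 * N)],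
   which is below [M / 2]. *)
have Tsub rho m : m \in dyadic_freq (B := B) n rho -> m \in T.
  rewrite !finset.in_set => /forallP h.
  have : (\sum_i freq_size (m i) <= d.+1 * 2 ^ n)%N.
    rewrite -[in leqRHS](card_ord d.+1) -sum_nat_const; apply: leq_sum => i _.
    by apply: leq_trans (h i) _; rewrite leq_exp2l // box_exp_le.
  have h2 : (d.+1 * 2 ^ n < 4 * (d.+1 * N))%N by rewrite mulnCA ltn_pmul2l.
  move=> h1; move: hM; rewrite -mulnA.
  move: (d.+1 * N)%N (d.+1 * 2 ^ n)%N h1 h2 => a b.
  by have := even_halfK eM; move: M./2 (\sum_i _)%N => H x; lia.
have E := discrepancy_mod_energy wM q eM (T := T).
have {}E := E (fun m h => etrans (esym (finset.in_set _ _)) h).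
set W := \sum_(m in T | _) _ in E.
set S := fun m : G => `|expsum w q m| ^+ 2.
have up : \sum_(rho : {ffun 'I_d -> 'I_B}) \sum_(m in dyadic_freq n rho | m != 0) S m <=
    (2 ^ d * 4 ^ n)%:R * W.
  rewrite (exchange_big_dep (fun m => (m \in T) && (m != 0))) /=; last first.
    by move=> r m _ /andP[/(Tsub r m) -> ->].
  rewrite mulr_sumr; apply: ler_sum => m /andP[mT m0].
  rewrite sumr_const -[leLHS]mulr_natr mulrCA ler_wpM2l ?exprn_ge0 //.
  rewrite ler_pdivlMr; last by rewrite ltr0n prodn_gt0 // => i; rewrite expn_gt0 freq_size_gt0.
  rewrite -natrM ler_nat; apply: leq_trans (count_boxes hn (fun i => freq_size_gt0 (m i))).
  rewrite leq_mul2r; apply/orP; right; apply: subset_leq_card; apply/fintype.subsetP => rho.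
  by rewrite /dyadic_freq unfold_in /= m0 andbT !finset.in_set.
have low : (B ^ d)%:R * (N%:R * ((2 ^ n)%:R - N%:R)) <=
    \sum_(rho : {ffun 'I_d -> 'I_B}) \sum_(m in dyadic_freq n rho | m != 0) S m.
  rewrite (_ : (B ^ d)%N = #|{: {ffun 'I_d -> 'I_B}}|); last by rewrite card_ffun !card_ord.
  rewrite mulr_natl -sumr_const.
  by apply: ler_sum => rho _; apply: dyadic_expsum_ge.
(* As [2 N <= 2^n < 4 N], the product [N (2^n - N)] is at least [3/16] of [4^n], whence the factor
   8. *)
have key : (B ^ d)%:R <= (8 * 2 ^ d)%:R * W.
  have p4 : 0 < (4 ^ n)%:R :> C by rewrite ltr0n expn_gt0.
  rewrite -(ler_pM2r p4) [leRHS](_ : _ = 8 * ((2 ^ d * 4 ^ n)%:R * W)); last first.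
    by rewrite !natrM; ring.
  apply: le_trans (ler_wpM2l _ (le_trans low up)) => //.
  rewrite -natrB; last by lia.
  rewrite -!natrM ler_nat mulnCA leq_mul2l; apply/orP; right.
  by rewrite (expnMn 2 2); move: (2 ^ n)%N n1 n2 => K; nia.
apply: le_trans (ler_wpM2l _ key) _ => //.
by rewrite mulrCA ler_wpM2l.
Qed.

End Roth.

(** * A root of unity close to 1 *)

Section RootOfUnity.
Variable R : realType.
Local Open Scope complex_scope.

Lemma sin_le (x : R) : 0 <= x -> sin x <= x.
Proof.
move=> x0; have [|c _] := @MVT_segment _ sin cos _ _ x0.
  exact/continuous_subspaceT/continuous_sin.
rewrite sin0 !subr0 => ->; rewrite -[leRHS]mul1r ler_wpM2r // cos_le1 //.
Qed.

Lemma cos_double_sin (x : R) : cos (2 * x) = 1 - 2 * sin x ^+ 2.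
Proof. by rewrite mulr_natl cos_mulr2n cos2sin2; ring. Qed.

(** With [x = 2 pi / M] and [w = exp(i x)], [|1 - w|^2 = 2 (1 - cos x) = 4 sin(x/2)^2 <= x^2]. *)
Lemma prim_root_near1 (M : nat) : (0 < M)%N ->
  exists2 w : R[i], M.-primitive_root w & `|1 - w| ^+ 2 <= ((2 * pi / M%:R) ^+ 2)%:C.
Proof.
move=> M0; have M0' : 0 < M%:R :> R by rewrite ltr0n.
pose x : R := 2 * pi / M%:R; pose w : R[i] := cos x +i* sin x.
have de_moivre n : w ^+ n = cos (n%:R * x) +i* sin (n%:R * x).
  elim: n => [|n IH]; first by rewrite mul0r cos0 sin0.
  rewrite exprS IH -natr1 mulrDl mul1r addrC cosD sinD.
  by congr (_ +i* _); ring.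
exists w.
  rewrite /primitive_root_of_unity M0 /=; apply/forallP => i.
  rewrite unity_rootE de_moivre; case: (eqVneq i.+1 M) => [h|h]; last first.
    have iM : (i.+1 < M)%N by have := ltn_ord i; lia.
    rewrite eqbF_neg; apply/negP => /eqP [+ _].
    (* [cos (2 t) = 1] would force [sin t = 0], whereas [0 < t < pi]. *)
    rewrite (_ : _ * x = 2 * (i.+1%:R / M%:R * pi)); last by rewrite /x; field; rewrite gt_eqF.
    rewrite cos_double_sin => e.
    have : 0 < sin (i.+1%:R / M%:R * pi : R).
      apply: sin_gt0_pi; rewrite mulr_gt0 ?divr_gt0 ?ltr0n ?pi_gt0 //=.
      by rewrite gtr_pMl ?pi_gt0 // ltr_pdivrMr // mul1r ltr_nat.
    by move=> /(exprn_gt0 2); lra.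
  rewrite h (_ : M%:R * x = pi *+ 2) ?cos2pi ?sin2pi ?eqxx //.
  by rewrite /x mulrC divfK ?gt_eqF // mulr_natl.
rewrite -add_Re2_Im2 lecR /= sub0r sqrrN.
rewrite (_ : _ + _ = 2 * (1 - cos x)); last first.
  by rewrite sqrrB sin2cos2; ring.
have xE : x = 2 * (x / 2) by rewrite mulrC divfK.
have x2 : 0 <= x / 2 by rewrite !divr_ge0 ?mulr_ge0 ?pi_ge0.
have x2pi : x / 2 <= pi.
  rewrite /x ler_pdivrMr // ler_pdivrMr //.
  by rewrite mulrC -mulrA ler_wpM2l ?pi_ge0 // -natrM ler_nat; lia.
have s0 : 0 <= sin (x / 2) by rewrite sin_ge0_pi ?x2.
have := sin_le x2; rewrite [in cos x]xE cos_double_sin => sx.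
have : sin (x / 2) ^+ 2 <= (x / 2) ^+ 2 by rewrite lerXn2r.
by rewrite -/x; lra.
Qed.

End RootOfUnity.

(** Bounding [|1 - w|] by [2 pi / M] turns the factor [M ^ d.+1] into [1 / M ^ d.+1], the
    normalisation of a mean over the grid. *)
Lemma discrepancy_mod_ge_real (R : realType) (M' d N n B : nat)
    (q : 'I_N -> {ffun 'I_d.+1 -> 'I_M'.+2}) :
    ~~ odd M'.+2 ->
    (2 * N <= 2 ^ n)%N -> (2 ^ n < 4 * N)%N -> (18 * d.+1 * N <= M'.+2)%N -> (d * B.-1 <= n)%N ->
  (M'.+2./2)%:R * (B ^ d)%:R <= (8 * 2 ^ d)%:R *
    ((2 * pi) ^+ (2 * d.+1) / M'.+2%:R ^+ d.+1 *
     \sum_(k < M'.+2./2) \sum_x discrepancy_mod R q k x ^+ 2) :> R.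
Proof.
set M := M'.+2; move=> eM n1 n2 hM hn; have [w wM wn] := @prim_root_near1 R M isT.
have := discrepancy_mod_ge wM q eM n1 n2 hM hn.
have cE k x : `|discrepancy_mod R[i]%C q k x| ^+ 2 = (discrepancy_mod R q k x ^+ 2)%:C%C.
  have -> : discrepancy_mod R[i]%C q k x = (discrepancy_mod R q k x)%:C%C.
    rewrite /discrepancy_mod rmorphB rmorph_sum /= rmorphM rmorphXn fmorph_div rmorphM !rmorph_nat.
    congr (_ - _); apply: eq_bigr => m _.
    by rewrite rmorph_prod; apply: eq_bigr => i _; rewrite rmorph_nat.
  by rewrite -add_Re2_Im2 /= expr0n addr0.
have -> : \sum_(k < M./2) \sum_x `|discrepancy_mod R[i]%C q k x| ^+ 2 =
    (\sum_(k < M./2) \sum_x discrepancy_mod R q k x ^+ 2)%:C%C.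
  rewrite rmorph_sum; apply: eq_bigr => k _.
  by rewrite rmorph_sum; apply: eq_bigr => x _; rewrite cE.
set E := \sum_(k < M./2) _ => h.
have E0 : 0 <= E by apply: sumr_ge0 => k _; apply: sumr_ge0 => x _; rewrite sqr_ge0.
rewrite -lecR; apply: le_trans (_ : (M./2%:R * (B ^ d)%:R : R[i]%C) <= _).
  by rewrite rmorphM !rmorph_nat.
apply: le_trans h _; rewrite [in leRHS]rmorphM rmorph_nat ler_wpM2l //.
rewrite [in leRHS]rmorphM ler_wpM2r ?ler0c //.
rewrite exprM; apply: le_trans (_ : ((2 * pi / M%:R) ^+ 2)%:C%C ^+ d.+1 * M%:R ^+ d.+1 <= _).
  by rewrite ler_wpM2r ?exprn_ge0 // lerXn2r ?nnegrE ?exprn_ge0 // ler0c sqr_ge0.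
rewrite -rmorphXn -(rmorph_nat (real_complex R)) -rmorphXn -rmorphM lecR.
rewrite -exprM exprMn exprVn -mulrA ler_wpM2l ?exprn_ge0 ?mulr_ge0 ?pi_ge0 //.
by rewrite mul2n -addnn exprD invfM -mulrA mulVf ?mulr1 // expf_neq0 // pnatr_eq0.
Qed.

(** * From the torus to residues *)

Section TorusGrid.
Variables (R : realType) (M' : nat).
Local Notation M := M'.+2.

Definition residue (t : int) : 'I_M := inord `|(t %% M)%Z|%N.

Lemma residueE (t : int) : t = (residue t)%:Z + (t %/ M)%Z * M%:Z.
Proof.
rewrite {1}(divz_eq t M) addrC; congr (_ + _).
have t0 : 0 <= (t %% M)%Z by rewrite modz_ge0.
have tM : (t %% M)%Z < M by rewrite ltz_pmod.
by rewrite /residue inordK; lia.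
Qed.

Lemma arc_residue (k : nat) (a : 'I_M) (t : int) : (k.*2 <= M)%N ->
  arc k (residue t - a) <->
  exists l : int, - k%:Z <= t - a%:Z - l * M%:Z < k%:Z.
Proof.
move=> kM; have tE := residueE t; move: (residue t) (t %/ M)%Z tE => u c tE.
rewrite /arc val_subZp; have uM := ltn_ord u; have aM := ltn_ord a.
split.
  case: (leqP a u) => au; case/orP => h.
  - by exists c; lia.
  - by exists (c + 1); rewrite mulrDl; lia.
  - by exists (c - 1); rewrite mulrBl; lia.
  - by exists c; lia.
case=> l; rewrite tE => h.
(* [u] and [a] lie in [[0, M[] and [2 k <= M], so [l] is within 1 of the quotient [c]. *)
have : l = c \/ l = c + 1 \/ l = c - 1 by nia.
case=> [lE|[lE|lE]]; rewrite lE ?mulrDl ?mulrBl ?mul1r in h; case: (leqP a u) => au; lia.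
Qed.

(** Scaled by [M], the half-open interval has integer end points, so it contains a real exactly when
    it contains its floor. The shift by [M./2] matches the numbering of [JM]. *)
Lemma grid_coordinate (y : R) (a : 'I_M) (k : nat) : ~~ odd M -> (k.*2 <= M)%N ->
  arc k (residue (Num.floor (M%:R * y) + (M./2)%:Z) - a) <->
  exists l : int, - (k%:R / M%:R) <= y - (a%:Z - (M./2)%:Z)%:~R / M%:R - l%:~R < k%:R / M%:R.
Proof.
move=> eM kM; rewrite arc_residue //; have M0 : 0 < M%:R :> R by rewrite ltr0n.
have scale (l : int) : M%:R * (y - (a%:Z - (M./2)%:Z)%:~R / M%:R - l%:~R) =
    M%:R * y - (a%:Z - (M./2)%:Z + l * M%:Z)%:~R.
  by rewrite !intrD intrM -[M%:Z%:~R]pmulrn; field; rewrite gt_eqF.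
have shift (f b h l m : int) : (- m <= f + h - b - l < m) =
    (b - h + l - m <= f < b - h + l + m) by lia.
have floorE (l : int) :
    (- (k%:R / M%:R) <= y - (a%:Z - (M./2)%:Z)%:~R / M%:R - l%:~R < k%:R / M%:R) =
    (- k%:Z <= Num.floor (M%:R * y) + (M./2)%:Z - a%:Z - l * M%:Z < k%:Z).
  rewrite -[- (k%:R / _)]mulNr ler_pdivrMr // ltr_pdivlMr // mulrC scale lerBrDl ltrBlDl.
  by rewrite ![k%:R](pmulrn 1) -mulrNz -!intrD -floor_ge_int -floor_lt_int shift.
by split=> -[l h]; exists l; rewrite ?floorE // -floorE.
Qed.

End TorusGrid.

Lemma mem_shift_JM M (a : 'I_M) : (a%:Z - (M./2)%:Z)%R \in JM M.
Proof. by apply/imfsetP; exists (val a) => //=; rewrite mem_iota /= add0n. Qed.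

Section Bridge.
Variables (R : realType) (M' d : nat).
Local Notation M := M'.+2.
Local Notation G := {ffun 'I_d -> 'I_M'.+2}.

Definition shift_JM (a : 'I_M) : JM M := [` mem_shift_JM a]%fset.

Lemma shift_JM_bij : bijective shift_JM.
Proof.
apply: inj_card_bij; last by rewrite -cardfE card_JM card_ord.
by move=> a b /(congr1 val) /= /addIr [] /val_inj.
Qed.

Lemma reindex_JM (F : {ffun 'I_d -> JM M} -> R) :
  \sum_j F j = \sum_(x : G) F [ffun i => shift_JM (x i)].
Proof.
have [g gK Kg] := shift_JM_bij.
apply: reindex; exists (fun j : {ffun 'I_d -> JM M} => [ffun i => g (j i)]) => x _;
  by apply/ffunP => i; rewrite !ffunE ?gK ?Kg.
Qed.

Lemma mem_SM_ord (k : 'I_(M./2).-1) : ((k.+1)%:R / M%:R)%R \in SM R M.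
Proof. by apply/imfsetP; exists k.+1 => //=; rewrite mem_iota /= add1n ltnS. Qed.

Definition ord_SM k : SM R M := [` mem_SM_ord k]%fset.

Lemma ord_SM_bij : bijective ord_SM.
Proof.
apply: inj_card_bij; last by rewrite -cardfE card_SM // card_ord.
move=> k l /(congr1 val) /= /mulIf; rewrite invr_eq0 pnatr_eq0 => /(_ isT) /eqP.
by rewrite eqr_nat eqSS => /eqP /val_inj.
Qed.

Lemma reindex_SM (F : R -> R) :
  \sum_(s : SM R M) F (val s) = \sum_(k < (M./2).-1) F (k.+1%:R / M%:R).
Proof. by rewrite (reindex ord_SM) //; apply: onW_bij; apply: ord_SM_bij. Qed.

(** One configuration [q], obtained by rounding down, serves all centres and all sizes at once. *)
Lemma discrepancy_grid N (p : 'I_N -> torus R d) : ~~ odd M ->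
  exists q : 'I_N -> G, forall k (x : G), (k.*2 <= M)%N ->
    discrepancy (grid_point R [ffun i => shift_JM (x i)]) (k%:R / M%:R) p =
    discrepancy_mod R q k x.
Proof.
move=> eM; pose y n : 'rV[R]_d := repr (p n).
have yE n : p n = to_torus (y n) by rewrite /to_torus reprK.
exists (fun n => [ffun i => residue M' (Num.floor (M%:R * y n 0 i) + (M./2)%:Z)]) => k x kM.
rewrite /discrepancy /discrepancy_mod mulrA; congr (_ - _).
apply: eq_bigr => n _; rewrite indicE yE.
pose P i := arc k (residue M' (Num.floor (M%:R * y n 0 i) + (M./2)%:Z) - x i).
rewrite (eq_bigr (fun i => (P i)%:R)); last by move=> i _; rewrite ffunE.
have -> : \prod_i (P i)%:R = [forall i, P i]%:R :> R.
  case: forallP => [h|/forallP]; first by rewrite big1 // => i _; rewrite h.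
  rewrite negb_forall => /existsP[i /negbTE Pi].
  by rewrite (bigD1 i) //= Pi mul0r.
congr (_ %:R); congr nat_of_bool; apply/idP/idP.
  rewrite inE => /mem_translate_Q [l hl]; apply/forallP => i.
  apply/(grid_coordinate _ _ eM kM); exists (l i).
  by have := hl i; rewrite mxE ffunE.
move/forallP => h; rewrite inE; apply/mem_translate_Q.
have /choice [l hl] : forall i, exists l : int,
   - (k%:R / M%:R) <= y n 0 i - ((x i)%:Z - (M./2)%:Z)%:~R / M%:R - l%:~R < k%:R / M%:R.
  by move=> i; apply/grid_coordinate/h.
by exists l => i; have := hl i; rewrite mxE ffunE.
Qed.

End Bridge.

(** * Logarithms and choice of the constant *)

Lemma ln_nat_le (R : realType) (N n : nat) : (0 < N)%N -> (N <= 2 ^ n)%N -> ln (N%:R : R) <= n%:R.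
Proof.
move=> N0 Nn; rewrite -[leRHS]expRK ler_ln ?posrE ?expR_gt0 ?ltr0n //.
apply: le_trans (_ : 2 ^+ n <= _); first by rewrite -natrX ler_nat.
rewrite -[n%:R]mulr1 expRM_natl lerXn2r ?nnegrE ?expR_ge0 //.
exact: expR_ge1Dx.
Qed.

(** The mean over [k] starts at 0 while [SM] starts at [1 / M]; the extra term vanishes since the
    cube is empty in positive dimension. *)
Lemma discrepancy_mod0 (R : realType) M' d N (q : 'I_N -> {ffun 'I_d.+1 -> 'I_M'.+2}) x :
  discrepancy_mod R q 0 x = 0.
Proof.
rewrite /discrepancy_mod mulr0 mul0r expr0n mulr0 subr0 big1 // => n _.
by rewrite big_ord_recl /arc subn0 ltn0 leqNgt ltn_ord mul0r.
Qed.

Theorem theorem2 (R : realType) (d : nat) (hd : (1 <= d)%N) :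
  exists c : R, 0 < c /\
    forall (N : nat) (hN : (0 < N)%N)
           (M : nat) (hMeven : ~~ odd M) (hM : (18 * d * N <= M)%N)
           (p : 'I_N -> torus R d),
      Num.sqrt
        (1 / (#|` JM M|%:R) ^+ d * (1 / #|` SM R M|%:R) *
         \sum_(j : {ffun 'I_d -> JM M}) \sum_(s : SM R M)
           `|discrepancy (grid_point R j) (val s) p| ^+ 2)
      >= c * ln (N%:R : R) `^ ((d%:R - 1) / 2).
Proof.
case: d hd => // d _.
(* The factors come from the overlap of the boxes and from [|1 - w| <= 2 pi / M]. *)
pose A : R := (8 * 2 ^ d)%:R * (2 * pi) ^+ (2 * d.+1).
have A0 : 0 < A by rewrite mulr_gt0 ?exprn_gt0 ?mulr_gt0 ?pi_gt0 // ltr0n muln_gt0 expn_gt0.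
(* The power of [d.+1] is the loss in [ln N <= d.+1 * B]. *)
exists (Num.sqrt (A * d.+1%:R ^+ d)^-1); split.
  by rewrite sqrtr_gt0 invr_gt0 mulr_gt0 // exprn_gt0.
move=> N N0 M eM hM p.
have M18 : (18 <= M)%N by apply: leq_trans hM; rewrite -mulnA leq_pmulr // muln_gt0.
case: M => [|[|M']] // in eM hM M18 *.
have [q qE] := discrepancy_grid p eM.
have -> : \sum_(j : {ffun 'I_d.+1 -> JM M'.+2}) \sum_(s : SM R M'.+2)
    `|discrepancy (grid_point R j) (val s) p| ^+ 2 =
    \sum_(k < M'.+2./2) \sum_x discrepancy_mod R q k x ^+ 2.
  rewrite reindex_JM [RHS]exchange_big; apply: eq_bigr => x _.
  rewrite (reindex_SM M' (fun s => `|discrepancy _ s p| ^+ 2)).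
  rewrite [RHS](big_ord_recl M'./2) discrepancy_mod0 [0 ^+ 2]expr2 mul0r Monoid.mul1m /=.
  apply: eq_bigr => k _.
  rewrite qE; first by rewrite real_normK ?num_real.
  by have := ltn_ord k; have := even_halfK eM => /=; lia.
have [n [n1 n2]] : exists n, (2 * N <= 2 ^ n)%N /\ (2 ^ n < 4 * N)%N.
  exists (up_log 2 (2 * N)); have := @up_log_bounds 2 (2 * N) isT (leq_pmulr 2 N0).
  by case: (up_log _ _) => [|m] /=; rewrite ?expn0 ?expnS; lia.
(* Exponents up to [n / d.+1] keep the sum of [d] of them below [n], while [n < d.+1 * B] bounds the
   logarithm. *)
pose B := (n %/ d.+1).+1.
have hn : (d * B.-1 <= n)%N.
  by apply: leq_trans (leq_trunc_div n d.+1); rewrite mulnC leq_mul2l leqnSn orbT.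
have := discrepancy_mod_ge_real R q eM n1 n2 hM hn.
set S := \sum_(k < _) _ => S_lower.
have lnN0 : 0 <= ln (N%:R : R) by rewrite ln_ge0 // ler1n.
have lnB : ln (N%:R : R) <= d.+1%:R * B%:R.
  apply: le_trans (ln_nat_le _ N0 (_ : N <= 2 ^ n)%N) _; first by lia.
  by rewrite -natrM ler_nat mulnC ltnW // ltn_ceil.
have -> : (d.+1%:R - 1) / 2 = d%:R * 2^-1 :> R by rewrite -natr1 addrK.
rewrite powRrM powR12_sqrt ?powR_ge0 // powR_mulrn // -sqrtrM; last first.
  by rewrite invr_ge0 mulr_ge0 ?exprn_ge0 // ltW.
apply: ler_wsqrtr; rewrite card_JM card_SM //.
have H1 : 0 < (M'.+2./2.-1)%:R :> R by rewrite ltr0n; lia.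
have Mp : 0 < M'.+2%:R ^+ d.+1 :> R by rewrite exprn_gt0 // ltr0n.
have S_ge : A^-1 * B%:R ^+ d * M'.+2./2%:R <= S / M'.+2%:R ^+ d.+1.
  rewrite -mulrA ler_pdivrMl // mulrC -natrX; apply: le_trans S_lower _.
  by rewrite /A -!mulrA [S / _]mulrC.
apply: le_trans (_ : A^-1 * B%:R ^+ d <= _).
  rewrite invfM -mulrA ler_pM2l ?invr_gt0 // mulrC ler_pdivrMr ?exprn_gt0 //.
  by rewrite -exprMn lerXn2r ?nnegrE ?mulr_ge0 // mulrC.
(* The lower bound carries [M / 2], which exceeds the cardinal [M / 2 - 1] of [SM]. *)
rewrite !mul1r mulrAC ler_pdivlMr // mulrC [_ * S]mulrC.
apply: le_trans S_ge; rewrite mulrC ler_wpM2l //.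
  by rewrite mulr_ge0 ?invr_ge0 ?exprn_ge0 // ltW.
by rewrite ler_nat leq_pred.
Qed.
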